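(* Let $A\subset C$ be a finite extension of commutative rings such that $C$ is a projective $A$-module and the induced map $\mathrm{Spec}(C)\to \mathrm{Spec}(A)$ is a homeomorphism. Then there is a one-to-one correspondence between the set of intermediate subrings $A\subset B\subset C$ such that $C$ is a projective $B$-module, and the set of unital $A$-subalgebras $H\subset \mathrm{End}_A(C)$ such that $H$ is a left $C$-module direct summand of $\mathrm{End}_A(C)$. It is given by the mutually inverse maps $B\mapsto \mathrm{End}_B(C)$ and $H\mapsto B_H$, where $$B_H:=\{x\in C:\ \varphi(xc)=x\,\varphi(c)\ \text{ for all } \varphi\in H \text{ and all } c\in C\}.$$
   Context: Rings $A,B,C$ are commutative with identity $1\ne0$ (of arbitrary characteristic). A ring extension $A\subset C$ is finite if $C$ is a finitely generated $A$-module. $\mathrm{End}_A(C)$ is the set of $A$-linear maps $C\to C$; it is a (generally noncommutative) unital $A$-algebra under composition and a left $C$-module by $(c\cdot\varphi)(x)=c\,\varphi(x)$. A unital $A$-subalgebra is one containing the identity endomorphism. ''$C$-module direct summand'' means $H$ is a left $C$-submodule of $\mathrm{End}_A(C)$ admitting a complementary left $C$-submodule. *)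

(* Defs.v *)
From HB Require Import structures.
From mathcomp Require Import all_boot all_order all_algebra.
From mathcomp Require Import ring_quotient.
From mathcomp Require Import all_classical.
From mathcomp Require Import topology_structure.

Set Implicit Arguments.
Unset Strict Implicit.
Unset Printing Implicit Defensive.

Import GRing.Theory.

Local Open Scope classical_set_scope.
Local Open Scope ring_scope.

Definition finitely_generated (R : nzRingType) (M : lmodType R) : Prop :=
  exists (n : nat) (e : 'I_n -> M),
    forall x : M, exists c : 'I_n -> R, x = \sum_(i < n) c i *: e i.

Definition projective (R : nzRingType) (M : lmodType R) : Prop :=
  forall (U V : lmodType R) (p : {linear U -> V}) (f : {linear M -> V}),
    (forall v, exists u, p u = v) ->
    exists g : {linear M -> U}, forall x, p (g x) = f x.

(* E is a submodule of M; the last clause forces H and the complement K to lie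
   in E. *)
Definition direct_summand (R : nzRingType) (M : lmodType R) (E H : set M) :
    Prop :=
  exists K : set M,
    [/\ submod_closed [in H], submod_closed [in K], H `&` K = [set 0]
      & [set h + k | h in H & k in K] = E].

Definition Spec (R : comNzRingType) : Type := prime_idealr R.

HB.instance Definition _ (R : comNzRingType) := gen_eqMixin (Spec R).
HB.instance Definition _ (R : comNzRingType) := gen_choiceMixin (Spec R).

Section SpecTheory.
Variable R : comNzRingType.

Definition spec_pred (P : Spec R) : {pred R} := PrimeIdealr.sort P.

Lemma spec_idealr (P : Spec R) : idealr_closed (spec_pred P).
Proof.
split; first exact: (idealr0 (P : prime_idealr R)).
  by have /= -> := idealr1 (P : prime_idealr R).
move=> a u v uP vP; apply: (@rpredD _ (P : prime_idealr R)) => //.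
exact: (idealMr (idealrI := (P : prime_idealr R))).
Qed.

Lemma spec_prime (P : Spec R) : prime_idealr_closed (spec_pred P).
Proof. by move=> u v; have /= -> := prime_idealrM (P : prime_idealr R) u v. Qed.

Lemma spec_ext (P Q : Spec R) : spec_pred P =i spec_pred Q -> P = Q.
Proof.
case: P Q => [P p] [Q q] PQ.
have {}PQ : P = Q by apply/funext => x; exact: (PQ x).
case: _ / PQ q => q; congr PrimeIdealr.Pack.
case: p q => [[p1] [p2] [p3] [p4]] [[q1] [q2] [q3] [q4]].
by rewrite (Prop_irrelevance p1 q1) (Prop_irrelevance p2 q2)
  (Prop_irrelevance p3 q3) (Prop_irrelevance p4 q4).
Qed.

(* The closed sets are the loci V(S) of the primes containing a subset S of R;
   the open sets are their complements. *)
Definition zariski_open : set_system (Spec R) :=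
  [set U | exists S : set R,
     U = ~` [set P : Spec R | S `<=` [set` spec_pred P]]].

Program Definition zariski_topology :=
  @isOpenTopological.Build (Spec R) zariski_open _ _ _.
Next Obligation.
exists [set 1]; apply/esym/seteqP; split=> // P _ /(_ 1 erefl) /= P1.
by have [_ /negP] := spec_idealr P.
Qed.
Next Obligation.
move=> _ _ [S ->] [T ->]; exists [set s * t | s in S & t in T].
rewrite -setCU; congr (~` _); apply/seteqP; split=> P /=.
  case=> SP _ [s Ss] [t Tt] <- /=; last first.
    have [P0 _ /(_ s t 0)] := spec_idealr P.
    by rewrite addr0; apply=> //; apply: SP.
  have [P0 _ /(_ t s 0)] := spec_idealr P.
  by rewrite addr0 mulrC; apply=> //; apply: SP.
move=> STP; apply: contrapT => /not_orP[/existsNP[s /not_implyP[Ss sP]]].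
move=> /existsNP[t /not_implyP[Tt tP]].
have /(spec_prime (P := P))/orP[] : s * t \in spec_pred P; last 2 first.
- exact: sP.
- exact: tP.
by apply: STP; exists s => //; exists t.
Qed.
Next Obligation.
move=> I f /choice[S fS]; exists (\bigcup_i S i).
rewrite (eq_bigcupr (fun i _ => fS i)) -setC_bigcap; congr (~` _).
apply/seteqP; split=> P /= SP; first by move=> x [i _ /SP]; apply.
by move=> i _ x Sx; apply: SP; exists i.
Qed.
HB.instance Definition _ := zariski_topology.

End SpecTheory.

Section SpecMap.
Variables (R S : comNzRingType) (f : {rmorphism R -> S}).

Definition contraction (P : Spec S) : {pred R} :=
  [pred x | f x \in spec_pred P].

Lemma contraction_idealr P : idealr_closed (contraction P).
Proof.
have [P0 P1 PM] := spec_idealr P.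
split; rewrite ?inE ?rmorph0 ?rmorph1 // => a u v; rewrite !inE => uP vP.
by rewrite rmorphD rmorphM PM.
Qed.

Lemma contraction_prime P : prime_idealr_closed (contraction P).
Proof. by move=> u v; rewrite !inE rmorphM => /spec_prime. Qed.

HB.instance Definition _ P := isIdealr.Build R (contraction P)
  (contraction_idealr P).
HB.instance Definition _ P := isPrimeIdealrClosed.Build R (contraction P)
  (@contraction_prime P).

Definition Spec_map (P : Spec S) : Spec R := contraction P : prime_idealr R.

End SpecMap.

Definition homeomorphism (X Y : topologicalType) (f : X -> Y) : Prop :=
  exists g : Y -> X, [/\ cancel f g, cancel g f, continuous f & continuous g].

Section Subring.
Variables (C : comNzRingType) (B : subringClosed C).

Definition subring_type : Type := {x : C | x \in B}.
HB.instance Definition _ := SubChoice.on subring_type.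
HB.instance Definition _ :=
  [SubChoice_isSubComNzRing of subring_type by <:].

Definition subring_incl : {rmorphism subring_type -> C} := \val.

End Subring.

(* C as a B-module; B is a phantom argument that selects the scalars. *)
Definition restrict_scalars (C : comNzRingType) (B : subringClosed C) : Type :=
  C.
Arguments restrict_scalars {C} B.

Section RestrictScalars.
Variables (C : comNzRingType) (B : subringClosed C).

HB.instance Definition _ := GRing.Zmodule.copy (restrict_scalars B) C.

Definition restrict_scale (b : subring_type B) (x : restrict_scalars B) :
  restrict_scalars B := (val b : C) * (x : C).

Fact restrict_scaleA a b x :
  restrict_scale a (restrict_scale b x) = restrict_scale (a * b) x.
Proof. by rewrite /restrict_scale rmorphM mulrA. Qed.
Fact restrict_scale1 : left_id 1 restrict_scale.
Proof. by move=> x; rewrite /restrict_scale rmorph1 mul1r. Qed.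
Fact restrict_scaleDr : right_distributive restrict_scale +%R.
Proof. by move=> b x y; exact: mulrDr. Qed.
Fact restrict_scaleDl x : {morph restrict_scale^~ x : a b / a + b}.
Proof. by move=> a b; rewrite /restrict_scale rmorphD; exact: mulrDl. Qed.

HB.instance Definition _ :=
  GRing.Zmodule_isLmodule.Build (subring_type B) (restrict_scalars B)
    restrict_scaleA restrict_scale1 restrict_scaleDr restrict_scaleDl.

End RestrictScalars.

Section Correspondence.
Variable C : comNzRingType.

(* For a subring B of C this is End_B(C); see EndoP. *)
Definition Endo (B : set C) : set (C -> C) :=
  [set phi | {morph phi : x y / x + y}
             /\ (forall b x, B b -> phi (b * x) = b * phi x)].

Lemma EndoP (B : subringClosed C) (phi : C -> C) :
  Endo [set` B] phi <->
  linear (phi : restrict_scalars B -> restrict_scalars B).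
Proof.
split=> [[phiD phiZ] b x y | phiL].
  by rewrite phiD; congr (_ + _); apply: phiZ; exact: (valP b).
have phiD : {morph phi : x y / x + y}.
  by move=> x y; have := phiL 1 x y; rewrite !scale1r.
have phi0 : phi 0 = 0 by apply: (addIr (phi 0)); rewrite -phiD !add0r.
split=> // b x Bb.
by have := phiL (exist _ b Bb) x 0; rewrite !addr0 phi0 addr0.
Qed.

Definition invariants (H : set (C -> C)) : set C :=
  [set x | forall phi c, H phi -> phi (x * c) = x * phi c].

Variable A : subringClosed C.

Definition projective_intermediate_subrings : set (set C) :=
  [set S | exists B : subringClosed C,
     [/\ S = [set` B], [set` A] `<=` S & projective (restrict_scalars B)]].

Definition unital_subalgebra (H : set (C -> C)) : Prop :=
  [/\ H `<=` Endo [set` A], H idfun,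
      (forall phi psi, H phi -> H psi -> H (phi + psi)),
      (forall a phi, a \in A -> H phi -> H (fun x => a * phi x))
    & (forall phi psi, H phi -> H psi -> H (phi \o psi))].

(* The codomain C^o makes C -> C a left C-module for the pointwise action
   (c *: phi) x = c * phi x. *)
Definition summand_subalgebras : set (set (C -> C)) :=
  [set H | unital_subalgebra H
           /\ @direct_summand C (C -> C^o) (Endo [set` A]) H].

End Correspondence.

(* Main.v *)
(** If [C] is finite projective over [B], a dual basis [(e_i, f_i)] gives the
[C]-linear projection [phi |-> sum_i phi(e_i) f_i] of [End_A(C)] onto
[End_B(C)]; moreover [B] is a direct summand of [C], and evaluating a retraction
[C -> B] at [1] shows that the invariants of [End_B(C)] reduce to [B].

Conversely let [H] be a summand subalgebra and let [W] be the set of [w] in [H]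
with values in [B_H]. If [id = sum_i c_i w_i] with [w_i] in [W], then
[(c_i, w_i)] is a dual basis of [C] over [B_H] and [H = End_(B_H)(C)]. That [id]
lies in [C W] is local at a maximal ideal [m] of [A]. A single prime of [C] lies
over [m], so [H] is locally free of constant rank, and there are [x_j] in [C] and
a basis [w_j] of [H] with [w_j(x_k) = delta_jk], that is, [h = sum_j h(x_j) w_j]
for all [h] in [H]. Applied to [h \o w_k] this reads [h \o w_k = h(1) w_k], so
[w_k] lies in [W]. Denominators are cleared instead of localizing. *)
Require Import Defs.
From HB Require Import structures.
From mathcomp Require Import all_boot all_order all_algebra.
From mathcomp Require Import ring_quotient.
From mathcomp Require Import all_classical.
From mathcomp Require Import topology_structure.

Set Implicit Arguments.
Unset Strict Implicit.
Unset Printing Implicit Defensive.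

Import GRing.Theory.

Local Open Scope classical_set_scope.
Local Open Scope ring_scope.

(** * Submodules given as sets *)

Section Submodules.
Variables (R : nzRingType) (M : lmodType R).
Implicit Types (S : set M) (u v : M).

Lemma submod_intro S :
  S 0 -> (forall u v, S u -> S v -> S (u + v)) ->
  (forall a u, S u -> S (a *: u)) -> submod_closed [in S].
Proof.
move=> S0 SD SZ; split=> [|a u v]; first by rewrite inE.
by rewrite !inE => Su Sv; apply: SD => //; apply: SZ.
Qed.

Lemma submod0 S : submod_closed [in S] -> S 0.
Proof. by case; rewrite inE. Qed.

Lemma submodD S u v : submod_closed [in S] -> S u -> S v -> S (u + v).
Proof. by case=> _ /(_ 1 u v); rewrite !inE scale1r => + Su Sv; apply. Qed.

Lemma submodZ S a u : submod_closed [in S] -> S u -> S (a *: u).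
Proof.
by case=> S0 /(_ a u 0); rewrite !inE addr0 => + Su; apply=> //; rewrite inE in S0.
Qed.

Lemma submodN S u : submod_closed [in S] -> S u -> S (- u).
Proof. by move=> SS Su; rewrite -scaleN1r; apply: submodZ. Qed.

Lemma submodB S u v : submod_closed [in S] -> S u -> S v -> S (u - v).
Proof. by move=> SS Su Sv; apply: submodD => //; apply: submodN. Qed.

Lemma submod_sum S :
  submod_closed [in S] ->
  forall (I : Type) (r : seq I) (P : pred I) (F : I -> M),
  (forall i, P i -> S (F i)) -> S (\sum_(i <- r | P i) F i).
Proof.
move=> SS I r P F SF; apply: (big_ind S) => //; first exact: submod0.
by move=> u v; apply: submodD.
Qed.

End Submodules.

(** * The determinant trick *)

Section Nakayama.
Variables (R : comNzRingType) (I : set R^o).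
Hypothesis idI : submod_closed [in I].

Lemma idealM_congr (a b c d : R) :
  I (a - b) -> I (c - d) -> I (a * c - b * d).
Proof.
move=> Iab Icd; have -> : a * c - b * d = a * (c - d) + d * (a - b).
  by rewrite !mulrBr (mulrC d a) (mulrC d b) addrA subrK.
by apply: (submodD idI); apply: (submodZ _ idI).
Qed.

Lemma ideal_det_congr n (P Q : 'M[R]_n) :
  (forall i j, I (P i j - Q i j)) -> I (\det P - \det Q).
Proof.
move=> PQ; rewrite /determinant -sumrB; apply: (submod_sum idI) => s _.
rewrite -mulrBr; apply: (submodZ _ idI).
elim/big_rec2: _ => [|i x y _ Ixy]; first by rewrite subrr; exact: submod0 idI.
exact: idealM_congr.
Qed.

(** The matrix [P = s - q] sends the family [e] into [N]; multiplying by its adjugate puts each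
    [\det P *: e k] in [N], and [\det P] is congruent to [s ^+ n] modulo [I]. A general [s] in place
    of [1] clears denominators without localizing. *)
Lemma nakayama (M : lmodType R) (N : set M) n (e : 'I_n -> M) (s : R) :
  submod_closed [in N] ->
  (forall k, exists q : 'I_n -> R, (forall l, I (q l)) /\
     N (s *: e k - \sum_l q l *: e l)) ->
  exists2 d, I (d - s ^+ n) & forall k, N (d *: e k).
Proof.
move=> NN /choice[q qP]; pose P : 'M[R]_n := \matrix_(k, l) (s *+ (k == l) - q k l).
exists (\det P).
  rewrite -(det_scalar n s); apply: ideal_det_congr => i j.
  rewrite !mxE addrAC subrr sub0r; apply: (submodN idI).
  by have [qI _] := qP i; exact: qI.
move=> k.
have PN i : N (\sum_l P i l *: e l).
  have [_] := qP i; congr N.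
  under [RHS]eq_bigr => l _ do rewrite mxE scalerBl.
  rewrite sumrB; congr (_ - _); rewrite (bigD1 i) //= eqxx big1 ?addr0 // => j.
  by rewrite eq_sym => /negPf->; rewrite mulr0n scale0r.
suff -> : \det P *: e k = \sum_i (\adj P) k i *: \sum_l P i l *: e l.
  by apply: (submod_sum NN) => i _; apply: (submodZ _ NN).
under eq_bigr => i _ do rewrite scaler_sumr.
rewrite exchange_big /=.
transitivity (\sum_l (\adj P *m P) k l *: e l).
  rewrite mul_adj_mx (bigD1 k) //= mxE eqxx big1 ?addr0 // => j.
  by rewrite eq_sym => /negPf; rewrite mxE => ->; rewrite mulr0n scale0r.
apply: eq_bigr => l _; rewrite mxE scaler_suml; apply: eq_bigr => i _.
by rewrite scalerA.
Qed.

End Nakayama.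

(** * Maximal ideals as points of the spectrum *)

Section MaximalIdeals.
Variable R : comNzRingType.

Lemma spec_of (S : {pred R}) :
  idealr_closed S -> prime_idealr_closed S -> exists P : Spec R, spec_pred P = S.
Proof.
move=> Si Sp.
pose P : prime_idealr R :=
  HB.pack S (isIdealr.Build R S Si) (isPrimeIdealrClosed.Build R S Sp).
by exists P.
Qed.

Lemma spec_submod (P : Spec R) :
  submod_closed [in ([set` spec_pred P] : set R^o)].
Proof.
have [P0 _ PM] := spec_idealr P.
apply: submod_intro => //= [u v Pu Pv|a u Pu].
  by have := PM 1 u v Pu Pv; rewrite mul1r.
by have := PM a u 0 Pu P0; rewrite addr0.
Qed.

(* The last clause is maximality. *)
Lemma ex_maximal_ideal (J : set R^o) :
  submod_closed [in J] -> ~ J 1 ->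
  exists2 P : Spec R, J `<=` [set` spec_pred P] &
    forall x, x \notin spec_pred P -> exists y, 1 - y * x \in spec_pred P.
Proof.
move=> JJ J1.
pose proper (X : set R^o) :=
  X = set0 \/ [/\ submod_closed [in X], J `<=` X & ~ X 1].
have [F FP Ftot|X [PX Xmax]] := @Zorn_bigcup R^o proper.
  have [F0|/set0P[x0 [X0 FX0 X0x0]]] := eqVneq (\bigcup_(X in F) X) set0.
    by left.
  have FPx X x : F X -> X x -> [/\ submod_closed [in X], J `<=` X & ~ X 1].
    by move=> FX Xx; case: (FP _ FX) => // X0'; rewrite X0' in Xx.
  right; have [SX0 JX0 _] := FPx _ _ FX0 X0x0; split.
  - apply: submod_intro => [|u v [U FU Uu] [V FV Vv]|a u [U FU Uu]].
    + by exists X0 => //; exact: submod0.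
    + have [SU _ _] := FPx _ _ FU Uu; have [SV _ _] := FPx _ _ FV Vv.
      by have [/(_ _ Uu)|/(_ _ Vv)] := Ftot _ _ FU FV => ?;
        [exists V|exists U] => //; apply: submodD.
    + by have [SU _ _] := FPx _ _ FU Uu; exists U => //; apply: submodZ.
  - by move=> x /JX0; exists X0.
  - by move=> [U FU U1]; have [_ _] := FPx _ _ FU U1; apply.
have {PX} [SX JX X1] : [/\ submod_closed [in X], J `<=` X & ~ X 1].
  case: PX => // X0; exfalso; apply: (Xmax J); last by right; split.
  by rewrite X0; split=> // /(_ 0 (submod0 JJ)).
have Xinv x : ~ X x -> exists y, X (1 - y * x).
  move=> Xx; apply: contrapT => /forallNP noy.
  (* If no [1 - y * x] lies in [X], the strictly larger ideal [X + R x] is still proper. *)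
  apply: (Xmax [set u | exists2 v, X v & exists y, u = v + y * x]).
    split=> [u Xu|/(_ x)]; first by exists u => //; exists 0; rewrite mul0r addr0.
    move=> XX; apply: Xx; apply: XX.
    by exists 0; [exact: (submod0 SX)|exists 1; rewrite mul1r add0r].
  right; split=> [|u /JX Xu|[v Xv [y]]].
  - apply: submod_intro => [|u v [u' Xu' [y ->]] [v' Xv' [z ->]]|a u [u' Xu' [y ->]]].
    + exists 0; first exact: (submod0 SX).
      by exists 0; rewrite mul0r addr0.
    + exists (u' + v'); first exact: (submodD SX).
      by exists (y + z); rewrite mulrDl addrACA.
    + exists (a * u'); first exact: (submodZ _ SX).
      by exists (a * y); rewrite -mulrA -mulrDr.
  - by exists u => //; exists 0; rewrite mul0r addr0.
  - by move=> e1; apply: (noy y); rewrite e1 addrK.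
have [|u v|P PX] := @spec_of [in X].
- split; [by rewrite inE; exact: (submod0 SX)|by rewrite notin_setE|].
  by move=> a u v; rewrite !inE => Xu Xv; apply: (submodD SX) => //; apply: (submodZ _ SX).
- rewrite !inE => Xuv; apply/orP; have [Xu|] := pselect (X u).
    by left; rewrite inE.
  move=> /Xinv[y Xy]; right; rewrite inE.
  have -> : v = v * (1 - y * u) + y * (u * v).
    by rewrite mulrBr mulr1 mulrCA (mulrC v u) subrK.
  by apply: (submodD SX); apply: (submodZ _ SX).
have PE x : x \in spec_pred P <-> X x by rewrite PX inE.
exists P => [x /JX /PE //|x xP]; have [|y Xy] := Xinv x.
  by move/PE; rewrite (negPf xP).
by exists y; apply/PE.
Qed.

End MaximalIdeals.

(** * Dual bases of finite projective modules *)

Section DualBasis.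
Variables (C : comNzRingType) (B : subringClosed C).
Implicit Types (b : subring_type B) (x y : C).
Local Notation CB := (restrict_scalars B).
Local Notation BB := ((subring_type B)^o).

Definition dual_basis n (e : 'I_n -> C) (f : 'I_n -> {linear CB -> BB}) :=
  forall x, x = \sum_i val (f i x) * e i.

Lemma scale_restrict b (x : CB) : b *: x = val b * x :> C.
Proof. by []. Qed.

Lemma linear_mulr (f : {linear CB -> BB}) b (x : CB) : f (b *: x) = f x * b.
Proof. by rewrite linearZ; exact: mulrC. Qed.

(** Projectivity splits the surjection from the free module [B^n]; the [f i] are the coordinates of
    the section. *)
Lemma projective_dual_basis :
  finitely_generated CB -> projective CB ->
  exists n (e : 'I_n -> C) (f : 'I_n -> {linear CB -> BB}), dual_basis e f.
Proof.
move=> [n [e eP]] projC.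
pose p (u : 'rV[subring_type B]_n) : CB := \sum_i u 0 i *: (e i : CB).
have pL : linear p.
  move=> a u v; rewrite /p scaler_sumr -big_split /=; apply: eq_bigr => i _.
  by rewrite !mxE scalerDl scalerA.
pose pl : {linear 'rV[subring_type B]_n -> CB} :=
  HB.pack p (GRing.isLinear.Build _ _ _ _ p pL).
have [|g gP] := projC _ _ pl idfun.
  move=> x; have [c ->] := eP x; exists (\row_i c i).
  by rewrite /pl /= /p; apply: eq_bigr => i _; rewrite mxE.
have fL i : linear (fun x : CB => g x 0 i : BB).
  by move=> a x y; rewrite linearP !mxE.
pose f i : {linear CB -> BB} :=
  HB.pack (fun x : CB => g x 0 i : BB)
    (GRing.isLinear.Build _ _ _ _ (fun x : CB => g x 0 i : BB) (fL i)).
by exists n, e, f => x; rewrite -[LHS]gP.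
Qed.

Lemma Endo_val (f : {linear CB -> BB}) : Endo [set` B] (fun x => val (f x) : C).
Proof.
apply/EndoP => b x y; rewrite linearP rmorphD; congr (_ + _).
Qed.

Lemma Endo_sum (phi : C -> C) n (b : 'I_n -> subring_type B) (e : 'I_n -> C) :
  Endo [set` B] phi ->
  phi (\sum_i val (b i) * e i) = \sum_i val (b i) * phi (e i).
Proof.
move=> [phiD phiM].
have phi0 : phi 0 = 0 by apply: (addrI (phi 0)); rewrite -phiD !addr0.
rewrite (big_morph phi phiD phi0); apply: eq_bigr => i _.
by apply: phiM; exact: (valP (b i)).
Qed.

(* The values [p 1] of the [B]-linear maps [p : C -> B] form an ideal [J] of [B]
   with [J C = C], since [1 = sum_i f_i(1) e_i]; Nakayama gives [1 \in J]. *)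
Lemma dual_basis_split n (e : 'I_n -> C) (f : 'I_n -> {linear CB -> BB}) :
  dual_basis e f -> exists2 p : CB -> BB, linear p & p 1 = 1.
Proof.
move=> ef.
pose J : set BB := [set b | exists2 p : CB -> BB, linear p & p 1 = b].
have JJ : submod_closed [in J].
  apply: submod_intro => [|_ _ [p pL <-] [r rL <-]|a _ [p pL <-]].
  - by exists (fun=> 0) => // a x y; rewrite scaler0 addr0.
  - exists (fun x => p x + r x) => // a x y.
    by rewrite pL rL scalerDr addrACA.
  - exists (fun x => a *: p x) => // b x y.
    by rewrite pL scalerDr !scalerA mulrC.
have fJ i : J (f i 1) by exists (f i) => //; exact: linearP.
have N0 : submod_closed [in [set 0 : CB]].
  apply: submod_intro => //= [u v -> ->|a u ->]; first by rewrite addr0.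
  by rewrite scaler0.
have [|d Jd de] := @nakayama _ J JJ CB [set 0] n e 1 N0.
  (* Expand [e k = 1 * e k] with [1 = \sum_i f i 1 * e i], then each product [e i * e k] in the dual
     basis. *)
  move=> k; exists (fun l => \sum_i f l (e i * e k) * f i 1); split=> [l|/=].
    by apply: (submod_sum JJ) => i _; apply: (submodZ _ JJ).
  rewrite scale1r; apply/eqP; rewrite subr_eq0; apply/eqP.
  transitivity (\sum_i \sum_l val (f i 1) * (val (f l (e i * e k)) * e l)).
    rewrite -[LHS](mul1r (e k)) {1}(ef 1) mulr_suml; apply: eq_bigr => i _.
    by rewrite -mulr_sumr -ef mulrA.
  rewrite exchange_big /=; apply: eq_bigr => l _.
  rewrite scale_restrict rmorph_sum mulr_suml; apply: eq_bigr => i _.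
  by rewrite rmorphM mulrA (mulrC (val (f i 1))).
have {}de i : val d * e i = 0 := de i.
(* [d] kills every [e i], hence also [1]; so [d = 0], and [d - 1] in [J] gives [1] in [J]. *)
have d0 : d = 0.
  apply: val_inj; rewrite -[LHS]mulr1 [1]ef mulr_sumr big1 // => i _.
  by rewrite mulrCA de mulr0.
rewrite d0 expr1n sub0r in Jd.
have := submodN JJ Jd; rewrite opprK => J1.
by case: J1 => p pL p1; exists p.
Qed.

Lemma invariants_Endo n (e : 'I_n -> C) (f : 'I_n -> {linear CB -> BB}) :
  dual_basis e f -> invariants (Endo [set` B]) = [set` B].
Proof.
move=> /dual_basis_split[p pL p1].
pose pl : {linear CB -> BB} := HB.pack p (GRing.isLinear.Build _ _ _ _ p pL).
apply/seteqP; split=> [x /(_ _ 1 (Endo_val pl)) /= | x Bx phi c [_]]; last first.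
  by apply.
rewrite mulr1 p1 => px; have <- : val (p x) = x by exact: etrans px (mulr1 x).
exact: valP.
Qed.

End DualBasis.

(** * From intermediate rings to summand subalgebras *)

Section Enlarge.
Variables (C : comNzRingType) (A B : subringClosed C).
Hypothesis AB : [set` A] `<=` [set` B].

Lemma finitely_generated_restrict :
  finitely_generated (restrict_scalars A) ->
  finitely_generated (restrict_scalars B).
Proof.
move=> [n [e eP]]; exists n, e => x; have [c ->] := eP x.
by exists (fun i => exist _ (val (c i)) (AB (valP (c i)))).
Qed.

Lemma Endo_summand n (e : 'I_n -> C)
    (f : 'I_n -> {linear restrict_scalars B -> (subring_type B)^o}) :
  dual_basis e f -> summand_subalgebras A (Endo [set` B]).
Proof.
move=> ef; have EBA : Endo [set` B] `<=` Endo [set` A].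
  by move=> phi [phiD phiM]; split=> // a x /AB; apply: phiM.
split; first split=> //.
- by move=> phi psi [pD pM] [sD sM]; split=> [x y|b x Bb];
    rewrite !fctE ?pD ?sD 1?addrACA // pM // sM // mulrDr.
- by move=> a phi Aa [pD pM]; split=> [x y|b x Bb];
    rewrite ?pD ?mulrDr // pM // mulrCA.
- by move=> phi psi [pD pM] [sD sM]; split=> [x y|b x Bb] /=;
    rewrite ?sD ?pD // sM // pM.
(* [P phi] depends only on the values of [phi] at the [e i]; a [B]-linear [phi] is recovered from
   them. *)
pose P (phi : C -> C^o) : C -> C^o := fun x => \sum_i val (f i x) * phi (e i).
have PD phi psi : P (phi + psi) = P phi + P psi.
  apply/funext => x; rewrite !fctE /P -big_split; apply: eq_bigr => i _.
  by rewrite mulrDr.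
have PZ a phi : P (a *: phi) = a *: P phi.
  apply/funext => x; rewrite !fctE /P scaler_sumr; apply: eq_bigr => i _.
  by rewrite mulrCA.
have PE phi : Endo [set` B] phi -> P phi = phi.
  by move=> Ep; apply/funext => x; rewrite [in RHS](ef x) Endo_sum.
have EP phi : Endo [set` B] (P phi).
  split=> [x y|b x Bb].
    rewrite /P -big_split /=; apply: eq_bigr => i _.
    by rewrite linearD -mulrDl.
  rewrite /P mulr_sumr; apply: eq_bigr => i _.
  have -> : b * x = (exist _ b Bb : subring_type B) *: (x : restrict_scalars B).
    by [].
  by rewrite linearZ /= mulrA.
have EZ (D : set C) : @submod_closed C (C -> C^o) [in Endo D].
  apply: submod_intro => [|phi psi [pD pM] [sD sM]|a phi [pD pM]].
  - by split=> [x y|b x _]; [exact: esym (addr0 _)|exact: esym (mulr0 b)].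
  - by split=> [x y|b x Bb]; rewrite !fctE ?pD ?sD 1?addrACA // pM // sM // mulrDr.
  - by split=> [x y|b x Bb]; rewrite !fctE ?pD ?scalerDr // pM // scalerAr.
(* The complement is the kernel of [P] in [End_A(C)]. *)
exists [set phi | Endo [set` A] phi /\ P phi = 0]; split.
- exact: EZ.
- apply: submod_intro => /= [|u v [Eu Pu] [Ev Pv]|a u [Eu Pu]].
  + by split; [exact: (submod0 (EZ _))|rewrite PE //; exact: (submod0 (EZ _))].
  + by split; [exact: (submodD (EZ _))|rewrite PD Pu Pv addr0].
  + by split; [exact: (submodZ _ (EZ _))|rewrite PZ Pu scaler0].
- apply/seteqP; split=> [phi /= [Ep [_ <-]]|phi /= ->]; first by rewrite PE.
  by split; [|split]; rewrite ?PE //; exact: (submod0 (EZ _)).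
- apply/seteqP; split=> [_ [h /EBA Eh [k [Ek _] <-]]|phi Ep].
    exact: (submodD (EZ _)).
  exists (P phi); first exact: EP.
  exists (phi - P phi); last by rewrite addrC subrK.
  split; first by apply: (submodB (EZ _)) => //; exact: EBA (EP _).
  by rewrite PD -scaleN1r PZ scaleN1r (PE (P phi)) ?subrr.
Qed.

End Enlarge.

(** Lifts [u i] of the finitely many [h (e i)] suffice: [x |-> \sum_i f i x *: u i] then lifts [h]
    by linearity. *)
Lemma dual_basis_projective (C : comNzRingType) (B : subringClosed C) n
    (e : 'I_n -> C)
    (f : 'I_n -> {linear restrict_scalars B -> (subring_type B)^o}) :
  dual_basis e f -> projective (restrict_scalars B).
Proof.
move=> ef U V p h psurj.
have /choice[u pu] : forall i, exists u, p u = h (e i) by move=> i.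
pose g (x : restrict_scalars B) : U := \sum_i f i x *: u i.
have gL : linear g.
  move=> b x y; rewrite /g scaler_sumr -big_split; apply: eq_bigr => i _.
  by rewrite linearP /= scalerDl scalerA.
pose gl : {linear restrict_scalars B -> U} :=
  HB.pack g (GRing.isLinear.Build _ _ _ _ g gL).
exists gl => x; rewrite /gl /= /g.
rewrite linear_sum [in RHS](ef x) [RHS](linear_sum h).
by apply: eq_bigr => i _; rewrite linearZ /= pu -linearZ.
Qed.

(** * The fibre of [Spec C] over a maximal ideal of [A] *)

Section UniquePrimes.
Variables (C : comNzRingType) (A : subringClosed C) (n : nat) (e : 'I_n -> C).
Variable f : 'I_n -> {linear restrict_scalars A -> (subring_type A)^o}.
Hypothesis ef : dual_basis e f.
Hypothesis Spec_inj : injective (Spec_map (subring_incl A)).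

(* [q] is the only prime containing [m C], so [t C + m C = C], and Nakayama
   gives an element of [1 + m] annihilating [C / t C]. *)
Lemma multiple_outside_prime (q : Spec C) (t : C) :
  let m := Spec_map (subring_incl A) q in
  (forall x, x \notin spec_pred m -> exists y, 1 - y * x \in spec_pred m) ->
  t \notin spec_pred q ->
  exists c (a : subring_type A), val a = c * t /\ a \notin spec_pred m.
Proof.
move=> m mmax tq.
have SA := spec_submod m; have [_ m1 _] := spec_idealr m.
(* This is [t C + m C]: an element lies in [m C] exactly when all its coordinates [f l] lie in
   [m]. *)
pose J : set C^o := [set x | exists c, forall l, f l (x - t * c) \in spec_pred m].
have fM l y x : (forall i, f i x \in spec_pred m) -> f l (y * x) \in spec_pred m.
  move=> fx; have -> : y * x = \sum_i f i x *: (y * e i : restrict_scalars A).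
    by rewrite {1}(ef x) mulr_sumr; apply: eq_bigr => i _; rewrite mulrCA.
  rewrite linear_sum; apply: (submod_sum SA) => i _.
  by rewrite linear_mulr; apply: (submodZ _ SA); exact: fx.
have JJ : submod_closed [in J].
  apply: submod_intro => [|x y [c xc] [d yd]|b x [c xc]].
  - by exists 0 => l; rewrite mulr0 subrr linear0; exact: (submod0 SA).
  - exists (c + d) => l; rewrite mulrDr opprD addrACA linearD.
    exact: (submodD SA (xc l) (yd l)).
  - exists (b * c) => l; rewrite mulrCA -[b *: x]/(b * x) -mulrBr; exact: fM.
have J1 : J 1.
  (* A maximal ideal [Q] containing [J] lies over [m] by maximality of [m], so [Q = q]; but [t] is
     in [J] and not in [q]. *)
  apply: contrapT => /(ex_maximal_ideal JJ)[Q JQ _].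
  have [_ Q1 _] := spec_idealr Q; have SQ := spec_submod Q.
  have mQ a : a \in spec_pred m -> val a \in spec_pred Q.
    move=> am; apply: JQ; exists 0 => l; rewrite mulr0 subr0.
    have -> : val a = a *: (1 : restrict_scalars A) by rewrite scale_restrict mulr1.
    by rewrite linear_mulr; exact: (submodZ _ SA am).
  have Qq : Q = q.
    apply: Spec_inj; apply: spec_ext => a; apply/idP/idP => [aQ|/mQ//].
    apply: contraT => /mmax[y /mQ yaQ]; move/negP: Q1; case.
    have -> : 1 = val (1 - y * a) + val y * val a :> C.
      by rewrite rmorphB rmorphM rmorph1 subrK.
    by apply: (submodD SQ) => //; exact: (submodZ _ SQ aQ).
  move/negP: tq; apply; rewrite -Qq; apply: JQ; exists 1 => l.
  by rewrite mulr1 subrr linear0; exact: (submod0 SA).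
pose N : set (restrict_scalars A) := [set x | exists c, x = c * t].
have NN : submod_closed [in N].
  apply: submod_intro => [|_ _ [c ->] [d ->]|b _ [c ->]].
  - by exists 0; rewrite mul0r.
  - by exists (c + d); rewrite mulrDl.
  - by exists (val b * c); rewrite -mulrA.
have [|d dm dN] := @nakayama _ _ SA (restrict_scalars A) N n e 1 NN.
  move=> k; have [c ck] : J (e k) by rewrite -[e k]mulr1; exact: (submodZ _ JJ J1).
  exists (fun l => f l (e k - t * c)); split => //; exists c.
  by rewrite scale1r -[X in _ - X]ef opprB addrC subrK mulrC.
have [c dc] : N (val d).
  have -> : val d = \sum_i f i 1 *: (d *: (e i : restrict_scalars A)).
    rewrite -[LHS]mulr1 {1}(ef 1) mulr_sumr; apply: eq_bigr => i _.
    by rewrite mulrCA.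
  by apply: (submod_sum NN) => i _; apply: (submodZ _ NN).
exists c, d; split=> //; apply: contra m1 => dm'.
by have := submodB SA dm' dm; rewrite expr1n opprB addrC subrK.
Qed.

End UniquePrimes.

(** * Local bases of a summand at a prime of [C] *)

Lemma dual_family_sum (C : comNzRingType) n (e : 'I_n -> C) (J : {set 'I_n})
    (h : 'I_n -> C -> C^o) (t : C) (b : 'I_n -> C) k :
  {in J &, forall j k, h j (e k) = t *+ (j == k)} -> k \in J ->
  (\sum_(j in J) b j *: h j) (e k) = b k * t.
Proof.
move=> ht Jk; rewrite fct_sumE (bigD1 k) //= big1 => [|j /andP[Jj jk]].
  by rewrite addr0 fctE ht // eqxx.
by rewrite fctE ht // (negPf jk) mulr0n scaler0.
Qed.

(* A maximal family of coordinates [e k] on which some [h] in [H] form, up to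
   [s] outside [q], a dual family, generates [H] modulo [q], hence, by Nakayama,
   up to a factor outside [q]. *)
Lemma summand_local_basis (C : comNzRingType) n (e : 'I_n -> C)
    (H : set (C -> C^o)) (g : 'I_n -> C -> C^o) (q : Spec C) :
  submod_closed [in H] -> (forall i, H (g i)) ->
  (forall phi, H phi -> phi = \sum_i phi (e i) *: g i) ->
  exists (J : {set 'I_n}) (h : 'I_n -> C -> C^o) (t : C),
    [/\ t \notin spec_pred q,
        forall j, j \in J -> H (h j),
        {in J &, forall j k, h j (e k) = t *+ (j == k)} &
        forall phi, H phi -> t *: phi = \sum_(j in J) phi (e j) *: h j].
Proof.
move=> SH Hg gP; have SQ := spec_submod q; have [q0 q1 _] := spec_idealr q.
pose indep (J : {set 'I_n}) := `[< exists (h : 'I_n -> C -> C^o) (s : C),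
    [/\ s \notin spec_pred q,
        forall j, j \in J -> H (h j) &
        {in J &, forall j k, h j (e k) = s *+ (j == k)}] >].
have indep0 : indep finset.set0.
  apply/asboolP; exists (fun=> 0), 1; split=> // [j|j k]; by rewrite finset.in_set0.
have [J /maxsetP[/asboolP[h [s [sq Hh hs]]] Jmax] _] := maxset_exists indep0.
have rest phi : H phi -> H (s *: phi - \sum_(j in J) phi (e j) *: h j).
  move=> Hp; apply: (submodB SH); first exact: (submodZ _ SH).
  by apply: (submod_sum SH) => j Jj; apply: (submodZ _ SH); exact: Hh.
have rest0 (phi : C -> C^o) k : k \in J ->
    (s *: phi - \sum_(j in J) phi (e j) *: h j) (e k) = 0.
  move=> Jk; have := dual_family_sum (fun j => phi (e j)) hs Jk.
  by rewrite !fctE => ->; rewrite [s *: _]mulrC subrr.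
(* By maximality of [J]: a value outside [q] at [e l] would let [l] be added to [J]. *)
have restq (phi : C -> C^o) l : H phi ->
    (s *: phi - \sum_(j in J) phi (e j) *: h j) (e l) \in spec_pred q.
  move=> Hp; set psi := (_ - _); have Hpsi : H psi := rest _ Hp.
  have psi0 k : k \in J -> psi (e k) = 0 := rest0 phi k.
  apply: contraT => lq.
  have lJ : l \notin J by apply: contra lq => /psi0->.
  have JlJ : l |: J = J.
    apply: Jmax; last exact: finset.subsetUr.
    (* Elimination at [e l] without division: the common diagonal value becomes [s * psi (e l)]. *)
    pose h' j := if j == l then s *: psi else psi (e l) *: h j - h j (e l) *: psi.
    apply/asboolP; exists h', (s * psi (e l)); split.
    - by apply/negP => /(spec_prime (P := q))/orP[]; apply/negP.
    - move=> j; rewrite finset.in_setU1 /h'; case: eqP => [_ _|_ /= Jj].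
        exact: (submodZ _ SH).
      by apply: (submodB SH); apply: (submodZ _ SH) => //; exact: Hh.
    - move=> j k; rewrite !finset.in_setU1 /h'.
      have [-> _|jl /= Jj] := eqVneq j l; have [-> _|kl /= Jk] := eqVneq k l.
      + by [].
      + by rewrite !fctE psi0 // scaler0.
      + by rewrite (negPf jl) !fctE [psi (e l) *: _]mulrC subrr.
      + by rewrite !fctE (psi0 k) // scaler0 subr0 hs // [_ *: _]mulrC mulrnAl.
  by move: lJ; rewrite -JlJ finset.setU11.
pose N : set (C -> C^o) :=
  [set phi | exists b : 'I_n -> C, phi = \sum_(j in J) b j *: h j].
have NN : submod_closed [in N].
  apply: submod_intro => [|_ _ [b ->] [d ->]|a _ [b ->]].
  - by exists (fun=> 0); rewrite big1 // => j _; rewrite scale0r.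
  - exists (fun j => b j + d j); rewrite -big_split; apply: eq_bigr => j _.
    by rewrite scalerDl.
  - exists (fun j => a * b j); rewrite scaler_sumr; apply: eq_bigr => j _.
    by rewrite scalerA.
have [|d dq dN] := @nakayama _ _ SQ _ N n g s NN.
  (* The remainder of [g k] lies in [H], so [gP] writes it through the [g l] with coefficients in
     [q]. *)
  move=> k; exists (fun l => (s *: g k - \sum_(j in J) g k (e j) *: h j) (e l)).
  split=> [l|]; first exact: restq.
  exists (fun j => g k (e j)); rewrite -gP; last exact: rest.
  by rewrite opprB addrC subrK.
(* Nakayama gives [d] congruent to [s ^+ n] modulo [q], so primality keeps [s * d] outside [q]. *)
have sqn k : s ^+ k \notin spec_pred q.
  elim: k => [//|k IH]; rewrite exprS.
  by apply/negP => /(spec_prime (P := q))/orP[]; apply/negP.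
have sdq : s * d \notin spec_pred q.
  apply/negP => /(spec_prime (P := q))/orP[]; first exact/negP.
  move=> dq'; have := submodB SQ dq' dq; rewrite opprB addrC subrK.
  exact/negP/sqn.
exists J, (fun j => d *: h j), (s * d); split=> //.
- by move=> j Jj; apply: (submodZ _ SH); exact: Hh.
- by move=> j k Jj Jk; rewrite !fctE hs // [_ *: _]mulrC mulrnAl.
move=> phi Hp.
have [b bP] : N (d *: phi).
  rewrite (gP _ Hp) scaler_sumr; apply: (submod_sum NN) => i _.
  by rewrite scalerA mulrC -scalerA; apply: (submodZ _ NN); exact: dN.
rewrite -scalerA bP scaler_sumr; apply: eq_bigr => j Jj.
(* Evaluation at [e j] identifies the unknown [b j]. *)
have dphi : d * phi (e j) = b j * s.
  by rewrite -(dual_family_sum b hs Jj) -bP.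
by rewrite !scalerA mulrC -dphi mulrC.
Qed.

(** * From summand subalgebras to rings of invariants *)

Section Summands.
Variables (C : comNzRingType) (A : subringClosed C) (n : nat) (e : 'I_n -> C).
Variable f : 'I_n -> {linear restrict_scalars A -> (subring_type A)^o}.
Hypothesis ef : dual_basis e f.
Variable H : set (C -> C^o).
Hypothesis sH : summand_subalgebras A H.

Lemma summand_submod : submod_closed [in H].
Proof. by case: sH => _ [K []]. Qed.

(** [g i] is the [H]-component of [f i] in [End_A(C) = H + K]. Since
    [phi = \sum_i phi (e i) *: f i], for [phi] in [H] the error lies both in [H] and in [K], hence
    vanishes. *)
Lemma summand_generators :
  exists g : 'I_n -> C -> C^o, (forall i, H (g i)) /\
    forall phi, H phi -> phi = \sum_i phi (e i) *: g i.
Proof.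
have [[HA _ _ _ _] [K [SH SK HK HKA]]] := sH.
have fHK i : exists g : C -> C^o, H g /\ K ((fun x => val (f i x)) - g).
  have : Endo [set` A] (fun x => val (f i x)) by exact: Endo_val.
  by rewrite -HKA => -[h Hh [k Kk <-]]; exists h; rewrite addrC addKr.
have [g gP] := choice fHK; exists g; split=> [i|phi Hp]; first by case: (gP i).
apply/eqP; rewrite -subr_eq0; apply/eqP.
have : [set (0 : C -> C^o)] (phi - \sum_i phi (e i) *: g i); last by [].
rewrite -HK; split.
  apply: (submodB SH) => //; apply: (submod_sum SH) => i _.
  by apply: (submodZ _ SH); case: (gP i).
have {1}-> : phi = \sum_i phi (e i) *: ((fun x => val (f i x)) : C -> C^o).
  apply/funext => x; rewrite {1}(ef x) (Endo_sum _ _ (HA _ Hp)) fct_sumE.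
  by apply: eq_bigr => i _; exact: mulrC.
rewrite -sumrB; apply: (submod_sum SK) => i _; rewrite -scalerBr.
by apply: (submodZ _ SK); case: (gP i).
Qed.

(** Precomposing with multiplication by [c] is composing with [c *: id], which lies in [H]; so [H]
    is also stable under the right action of [C]. *)
Lemma summand_mulr phi c : H phi -> H (fun x => phi (c * x)).
Proof.
have [[_ Hid _ _ Hcomp] _] := sH => Hp.
by apply: (Hcomp phi (c *: (idfun : C -> C^o))) => //;
  exact: (submodZ _ summand_submod).
Qed.

(** The set [W]; its elements turn out to be the [B_H]-linear maps from [C] to [B_H]. *)
Definition equivariant : set (C -> C^o) :=
  [set w | H w /\ forall x, invariants H (w x)].

(** The left [C]-module [C W]; the explicit finite sums supply the dual basis once the identity is
    in it. *)
Definition equivariant_span : set (C -> C^o) :=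
  [set phi | exists k (c : 'I_k -> C) (w : 'I_k -> C -> C^o),
     (forall i, equivariant (w i)) /\ phi = \sum_i c i *: w i].

Lemma submod_equivariant_span : submod_closed [in equivariant_span].
Proof.
apply: submod_intro => [|_ _ [k [c [w [wE ->]]]] [l [d [v [vE ->]]]]
  |a _ [k [c [w [wE ->]]]]].
- exists 0, (fun=> 0), (fun=> 0); split; first by case.
  by rewrite big_ord0.
- exists (k + l)%N,
    (fun i => match fintype.split i with inl i => c i | inr i => d i end),
    (fun i => match fintype.split i with inl i => w i | inr i => v i end).
  split=> [i|]; first by case: fintype.split.
  rewrite big_split_ord /=; congr (_ + _); apply: eq_bigr => i _.
    by rewrite (unsplitK (inl i)).
  by rewrite (unsplitK (inr i)).
- exists k, (fun i => a * c i), w; split=> //.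
  by rewrite scaler_sumr; apply: eq_bigr => i _; rewrite scalerA.
Qed.

Hypothesis Spec_bij : bijective (Spec_map (subring_incl A)).

(** The [a] in [A] with [a id] in [C W] form an ideal [I]. Were it proper, a maximal [m] would
    contain it, and a local basis of [H] at the prime over [m] would yield an element of [I] outside
    [m]. *)
Lemma id_equivariant_span : equivariant_span idfun.
Proof.
have [[HA Hid _ _ Hcomp] _] := sH.
have SE := submod_equivariant_span; have SH := summand_submod.
pose I : set (subring_type A)^o :=
  [set a | equivariant_span (val a *: (idfun : C -> C^o))].
have SI : submod_closed [in I].
  apply: submod_intro; rewrite /I /=.
  - by rewrite scale0r; exact: (submod0 SE).
  - by move=> a b Ia Ib; have := submodD SE Ia Ib; rewrite -scalerDl.
  - by move=> a b Ib; have := submodZ (val a) SE Ib; rewrite scalerA.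
suff I1 : I 1 by rewrite -[idfun](scale1r (idfun : C -> C^o)).
apply: contrapT => /(ex_maximal_ideal SI)[m Im mmax].
have [spec spec_l spec_r] := Spec_bij; rewrite -(spec_r m) in mmax Im.
have [g [Hg gP]] := summand_generators.
have [J [h [t [tq Hh ht hP]]]] := summand_local_basis (spec m) SH Hg gP.
(* Elements of [H] commute with scalars of [A], so the denominator [t] is replaced by a multiple [a]
   in [A], outside [m]. *)
have [c [a [at_ am]]] := multiple_outside_prime ef (bij_inj Spec_bij) mmax tq.
pose w j := c *: h j.
have Hw j : j \in J -> H (w j) by move=> Jj; apply: (submodZ _ SH); exact: Hh.
have wP phi : H phi -> val a *: phi = \sum_(j in J) phi (e j) *: w j.
  move=> Hp; rewrite at_ -scalerA hP // scaler_sumr; apply: eq_bigr => j _.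
  by rewrite !scalerA mulrC.
have wa : {in J &, forall j k, w j (e k) = val a *+ (j == k)}.
  by move=> j k Jj Jk; rewrite /w fctE ht // at_ -mulrnAr.
have wE j : j \in J -> equivariant (val a *: w j).
  move=> Jj; split=> [|y phi z Hp]; first by apply: (submodZ _ SH); exact: Hw.
  pose psi : C -> C^o := (fun x => phi (z * x)) \o w j.
  have Hpsi : H psi := Hcomp _ _ (summand_mulr z Hp) (Hw j Jj).
  have phiA (b : subring_type A) x : phi (val b * x) = val b * phi x.
    by have [_] := HA _ Hp; apply; exact: (valP b).
  (* The expansion [wP] of [psi] has a single term: [psi (e k)] is [val a * phi z] for [k = j] and
     [0] for the other [k] in [J]. *)
  have phiM : val a *: psi = phi z *: (val a *: w j).
    rewrite wP // (bigD1 j) //= big1 => [|k /andP[Jk kj]].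
      by rewrite addr0 scalerA /psi /= wa // eqxx mulr1n mulrC phiA mulrC.
    rewrite /psi /= wa // eq_sym (negPf kj) mulr0n mulr0.
    by have := phiA 0 0; rewrite rmorph0 !mul0r => ->; rewrite scale0r.
  have E : val a * phi (z * w j y) = phi z * (val a * w j y) :=
    congr1 (fun u : C -> C^o => u y) phiM.
  rewrite -[LHS]/(phi (val a * w j y * z)) -mulrA (mulrC (w j y)) phiA E.
  exact: mulrC.
(* One factor [a] expands the identity along the [w j], the other makes each [val a *: w j]
   equivariant; [a * a] stays outside the prime [m]. *)
have : I (a * a).
  have -> : I (a * a) = equivariant_span (val a *: (val a *: (idfun : C -> C^o))).
    by rewrite scalerA.
  rewrite (wP idfun) // scaler_sumr; apply: (submod_sum SE) => j Jj.
  rewrite scalerA mulrC -scalerA; apply: (submodZ _ SE).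
  exists 1%N, (fun=> 1), (fun=> val a *: w j); split=> [_|]; first exact: wE.
  by rewrite big_ord1 scale1r.
by move=> /Im /= /(spec_prime (P := Spec_map _ _))/orP[]; apply/negP.
Qed.

Lemma invariants_subring :
  exists B : subringClosed C, [set` B] = invariants H /\ [set` A] `<=` [set` B].
Proof.
have [[HA Hid _ _ _] _] := sH; pose S : {pred C} := [in invariants H].
have SS : subring_closed S.
  split=> [|x y|x y]; rewrite !inE.
  - by move=> phi c _; rewrite !mul1r.
  - move=> xI yI phi c Hp; have [phiD _] := HA _ Hp.
    rewrite mulrBl [RHS]mulrBl -(xI phi c Hp) -(yI phi c Hp).
    by apply: (addIr (phi (y * c))); rewrite -phiD !subrK.
  - by move=> xI yI phi c Hp; rewrite -mulrA xI // yI // mulrA.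
pose B : subringClosed C := HB.pack S (GRing.isSubringClosed.Build C S SS).
have BE : [set` B] = invariants H.
  by apply/seteqP; split=> x; rewrite /= /B /= /S inE.
exists B; split=> //; rewrite BE => a Aa phi c Hp.
by have [_ ->] := HA _ Hp.
Qed.

Lemma invariants_projective :
  projective_intermediate_subrings A (invariants H) /\ Endo (invariants H) = H.
Proof.
have [[HA _ _ _ _] _] := sH; have SH := summand_submod.
have [k [c [w [wE idE]]]] := id_equivariant_span.
have cw x : x = \sum_i c i * w i x.
  by rewrite -{1}[x]/((idfun : C -> C^o) x) idE fct_sumE.
have HE : H `<=` Endo (invariants H).
  move=> phi Hp; have [phiD _] := HA _ Hp; split=> // b x; exact.
have [B [BE AB]] := invariants_subring; split.
  exists B; rewrite -BE; split=> //.
  have wB i x : w i x \in B.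
    by have [_ /(_ x)] := wE i; rewrite -BE.
  pose v i (x : restrict_scalars B) : (subring_type B)^o := exist _ (w i x) (wB i x).
  have vL i : linear (v i).
    move=> b x y; apply: val_inj; have [Hw _] := wE i.
    have := HE _ Hw; rewrite -BE => /EndoP; exact.
  pose vl i : {linear restrict_scalars B -> (subring_type B)^o} :=
    HB.pack (v i) (GRing.isLinear.Build _ _ _ _ (v i) (vL i)).
  apply: (@dual_basis_projective _ _ k c vl) => x; rewrite {1}(cw x).
  by apply: eq_bigr => i _; rewrite mulrC.
apply/seteqP; split=> // phi; rewrite -BE => Ep.
(* A [B_H]-linear [phi] is determined by its values at the [c i], hence is a [C]-combination of the
   [w i] in [H]. *)
have -> : phi = \sum_i phi (c i) *: w i.
  apply/funext => x; rewrite {1}(cw x) fct_sumE.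
  have wB i : w i x \in B by have [_ /(_ x)] := wE i; rewrite -BE.
  pose b i : subring_type B := exist _ (w i x) (wB i).
  under eq_bigr => i _ do rewrite mulrC -[w i x]/(val (b i)).
  by rewrite Endo_sum //; apply: eq_bigr => i _; exact: mulrC.
by apply: (submod_sum SH) => i _; apply: (submodZ _ SH); case: (wE i).
Qed.

End Summands.

(** * The two maps and their mutual inverseness *)

Theorem theorem2 (C : comNzRingType) (A : subringClosed C) :
  finitely_generated (restrict_scalars A) ->
  projective (restrict_scalars A) ->
  homeomorphism (Spec_map (subring_incl A)) ->
  [/\ set_fun (projective_intermediate_subrings A) (summand_subalgebras A)
        (@Endo C),
      set_fun (summand_subalgebras A) (projective_intermediate_subrings A)
        (@invariants C),
      {in projective_intermediate_subrings A,
        cancel (@Endo C) (@invariants C)}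
    & {in summand_subalgebras A, cancel (@invariants C) (@Endo C)}].
Proof.
move=> fgA projA [spec [spec_l spec_r _ _]].
have bij : bijective (Spec_map (subring_incl A)) by exists spec.
have [n [e [f ef]]] := projective_dual_basis fgA projA.
split=> [_ [B [-> AB projB]]|H sH|S|H].
- have [k [d [h dh]]] := projective_dual_basis (finitely_generated_restrict AB fgA) projB.
  exact: (Endo_summand AB dh).
- by case: (invariants_projective ef sH bij).
- rewrite inE => -[B [-> AB projB]].
  have [k [d [h dh]]] := projective_dual_basis (finitely_generated_restrict AB fgA) projB.
  exact: (invariants_Endo dh).
- by rewrite inE => sH; case: (invariants_projective ef sH bij).
Qed.
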